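(* Let $K\subseteq\mathbb{R}^n$ be an extended second order cone, $L\subseteq\mathbb{R}^n$ a linear subspace and $c\in\mathbb{R}^n$. If $\{(K_1,L,c),\ldots,(K_\gamma,L,c)\}$ is a maximal relaxation sequence for $(K,L,c)$, then: (i) $(K,L,c)$ is strongly feasible if and only if $(K_\gamma,L,c)$ is strongly feasible; (ii) $(K,L,c)$ is in weak status if and only if $(K_\gamma,L,c)$ is weakly feasible; (iii) $(K,L,c)$ is strongly infeasible if and only if $(K_\gamma,L,c)$ is strongly infeasible.
   Context: The Lorentz cone in $\mathbb{R}^{k}$ is $\mathcal{K}^{k}=\{x\in\mathbb{R}^{k}\mid x_0\ge\|\overline{x}\|\}$, where $x=(x_0,\ldots,x_{k-1})$, $\overline{x}=(x_1,\ldots,x_{k-1})$ and $\|\cdot\|$ is the Euclidean norm; $\mathcal{K}^1=\{x\in\mathbb{R}\mid x\ge 0\}$. For $x\in\mathcal{K}^k$, its reflection is $x'=(x_0,-\overline{x})$. For $d\in\mathbb{R}^k$, $H_d^k=\{x\in\mathbb{R}^k\mid d^Tx\ge 0\}$ and $\mathrm{h}_d^k=\{\alpha d\mid\alpha\ge 0\}$. An extended second order cone is a direct product $K=K^{n_1}\times\cdots\times K^{n_q}\subseteq\mathbb{R}^n$, $n=n_1+\cdots+n_q$, where each $K^{n_i}\subseteq\mathbb{R}^{n_i}$ is one of: $\{0\}$; $\mathbb{R}^{n_i}$; the Lorentz cone $\mathcal{K}^{n_i}$; a half-space $H_d^{n_i}$ with $d\in\mathcal{K}^{n_i}\setminus\{0\}$;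 a half-line $\mathrm{h}_d^{n_i}$ with $d\in\mathcal{K}^{n_i}$. For $x\in\mathbb{R}^n$, $x_{n_i}\in\mathbb{R}^{n_i}$ denotes the $i$-th block of $x$. For $a\in K$, $\mathcal{H}_1(a,K)=\{i\mid K^{n_i}=\mathcal{K}^{n_i},\ a_{n_i}\in\mathrm{ri}\,\mathcal{K}^{n_i}\}$ and $\mathcal{H}_2(a,K)=\{i\mid K^{n_i}=\mathcal{K}^{n_i},\ a_{n_i}\in(\mathrm{relbd}\,\mathcal{K}^{n_i})\setminus\{0\}\}$, where $\mathrm{ri}$ is the relative interior and $\mathrm{relbd}$ the relative boundary. If $\mathcal{H}_1(a,K)\cup\mathcal{H}_2(a,K)\neq\emptyset$, the relaxation of $K$ by $a$ is $\widetilde{K}=\widetilde{K}^{n_1}\times\cdots\times\widetilde{K}^{n_q}$ with $\widetilde{K}^{n_i}=\mathbb{R}^{n_i}$ if $i\in\mathcal{H}_1(a,K)$, $\widetilde{K}^{n_i}=H_{a_{n_i}'}^{n_i}$ if $i\in\mathcal{H}_2(a,K)$, and $\widetilde{K}^{n_i}=K^{n_i}$ otherwise. For a closed convex cone $K$, a linear subspace $L$ of $\mathbb{R}^n$ and $c\in\mathbb{R}^n$, $(K,L,c)$ denotes the feasibility problem: find $x\in K\cap(L+c)$. It is strongly feasible if $(L+c)\cap\mathrm{ri}\,K\ne\emptyset$; weakly feasible if $K\cap(L+c)\ne\emptyset$ but $(L+c)\cap\mathrm{ri}\,K=\emptyset$; weakly infeasible if $K\cap(L+c)=\emptyset$ but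 the distance between $K$ and $L+c$ is $0$; strongly infeasible if $K\cap(L+c)=\emptyset$ and the distance between $K$ and $L+c$ is positive. It is in weak status if it is weakly feasible or weakly infeasible. A relaxation sequence for $(K,L,c)$ is a finite sequence $\{(K_1,L,c),\ldots,(K_\gamma,L,c)\}$ with $K_1=K$ such that every $K_i$ is an extended second order cone and, for each $i>1$, there is $d^{i-1}\in K_{i-1}\cap L$ such that $K_i$ is the relaxation of $K_{i-1}$ by $d^{i-1}$, and $K_{i-1}\subsetneq K_i$. The sequence is maximal if it does not admit further non-trivial relaxations, i.e. it cannot be extended by a further problem $(K_{\gamma+1},L,c)$ to a longer relaxation sequence. *)

(* Defs.v *)
From HB Require Import structures.
From mathcomp Require Import all_boot all_order all_algebra.
From mathcomp Require Import all_classical all_reals all_analysis.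

Set Implicit Arguments.
Unset Strict Implicit.
Unset Printing Implicit Defensive.

Import Order.TTheory GRing.Theory Num.Theory.
Import numFieldNormedType.Exports.

Local Open Scope classical_set_scope.
Local Open Scope ring_scope.

Section Euclidean.
Context {R : realType} {n : nat}.
Implicit Types (x y d : 'rV[R]_n) (A B : set 'rV[R]_n).

(* The library norm on matrices is the sup norm, hence this definition. *)
Definition norm2 x : R := Num.sqrt (\sum_(i < n) x 0 i ^+ 2).

Definition dot x y : R := \sum_(i < n) x 0 i * y 0 i.

Definition dist A B : \bar R :=
  ereal_inf [set (norm2 (x - y))%:E | x in A & y in B].

Definition affine_set A : Prop :=
  forall x y (t : R), A x -> A y -> A (t *: x + (1 - t) *: y).

Definition affine_hull A : set 'rV[R]_n := smallest affine_set A.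

(* Neighbourhoods are those of the library topology on matrices, i.e. the
   usual topology of R^n. *)
Definition relint A : set 'rV[R]_n :=
  [set x | affine_hull A x /\
           \forall y \near within (affine_hull A) (nbhs x), A y].

Definition relbd A : set 'rV[R]_n := closure A `\` relint A.

Definition half_space d : set 'rV[R]_n := [set x | 0 <= dot d x].

Definition half_line d : set 'rV[R]_n :=
  [set x | exists2 a : R, 0 <= a & x = a *: d].

End Euclidean.

Section Feasibility.
Context {R : realType} {n : nat}.
Variables (K : set 'rV[R]_n) (L : {vspace 'rV[R]_n}) (c : 'rV[R]_n).

Definition translate : set 'rV[R]_n := [set l + c | l in [set` L]].

Definition strongly_feasible : Prop := translate `&` relint K !=set0.

Definition weakly_feasible : Prop :=
  K `&` translate !=set0 /\ translate `&` relint K = set0.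

Definition weakly_infeasible : Prop :=
  K `&` translate = set0 /\ dist K translate = 0%E.

Definition strongly_infeasible : Prop :=
  K `&` translate = set0 /\ (0 < dist K translate)%E.

Definition weak_status : Prop := weakly_feasible \/ weakly_infeasible.

End Feasibility.

Section Lorentz.
Context {R : realType} {k : nat}.
Implicit Types x : 'rV[R]_k.+1.

Definition tail x : 'rV[R]_k := \row_(i < k) x 0 (lift ord0 i).

Definition lorentz : set 'rV[R]_k.+1 := [set x | norm2 (tail x) <= x 0 ord0].

Definition reflection x : 'rV[R]_k.+1 :=
  \row_i (if i == ord0 then x 0 i else - x 0 i).

Definition esoc_factor (C : set 'rV[R]_k.+1) : Prop :=
  C = [set 0] \/ C = setT \/ C = lorentz \/
  (exists2 d, (lorentz `\` [set 0]) d & C = half_space d) \/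
  (exists2 d, lorentz d & C = half_line d).

End Lorentz.

Section ExtendedSOC.
Context {R : realType} {q : nat} {m : 'I_q -> nat}.

(* The i-th block has dimension n_i = (m i).+1 >= 1, so n = n_1 + ... + n_q
   is \sum_i (m i).+1.  A direct product of blocks is given by its factors. *)
Definition blocks : Type := forall i : 'I_q, set 'rV[R]_(m i).+1.

Local Notation space := ('rV[R]_(\sum_i (m i).+1)).

Definition block (x : space) (i : 'I_q) : 'rV[R]_(m i).+1 := submxrow x i.

Definition product (K : blocks) : set space :=
  [set x | forall i, K i (block x i)].

Definition extended_soc (K : blocks) : Prop := forall i, esoc_factor (K i).

(* K i = lorentz is an equality of sets: in dimension 1 it also holds for a
   factor introduced as a half-space or a half-line. *)
Definition H1 (a : space) (K : blocks) : set 'I_q :=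
  [set i | K i = lorentz /\ relint lorentz (block a i)].

Definition H2 (a : space) (K : blocks) : set 'I_q :=
  [set i | K i = lorentz /\ (relbd lorentz `\` [set 0]) (block a i)].

Definition relaxation (K : blocks) (a : space) : blocks := fun i =>
  if i \in H1 a K then setT
  else if i \in H2 a K then half_space (reflection (block a i))
  else K i.

Definition relaxation_step (L : {vspace space}) (K K' : blocks) : Prop :=
  exists d : space,
    [/\ product K d, d \in L, H1 d K `|` H2 d K !=set0,
        K' = relaxation K d & product K `<` product K'].

(* L and c are constant along a sequence of problems (K_i, L, c) and c plays
   no role in the conditions, so only the cones K_i are listed. *)
Definition relaxation_sequence
    (L : {vspace space}) (K : blocks) (Ks : seq blocks) : Prop :=
  [/\ (0 < size Ks)%N,
      nth K Ks 0%N = K,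
      forall i, (i < size Ks)%N -> extended_soc (nth K Ks i)
    & forall i, (i.+1 < size Ks)%N ->
        relaxation_step L (nth K Ks i) (nth K Ks i.+1)].

Definition maximal_relaxation_sequence
    (L : {vspace space}) (K : blocks) (Ks : seq blocks) : Prop :=
  relaxation_sequence L K Ks /\
  ~ (exists K' : blocks, relaxation_sequence L K (rcons Ks K')).

End ExtendedSOC.

Arguments blocks R {q} m.

(* Main.v *)
Require Import Defs.
From HB Require Import structures.
From mathcomp Require Import all_boot all_order all_algebra.
From mathcomp Require Import all_classical all_reals all_analysis.
From mathcomp Require Import ring lra.

Set Implicit Arguments.
Unset Strict Implicit.
Unset Printing Implicit Defensive.

Import Order.TTheory GRing.Theory Num.Theory.
Import numFieldNormedType.Exports.

Local Open Scope classical_set_scope.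
Local Open Scope ring_scope.

(** Three observations carry the proof.

    The first is a reformulation that removes metrics and topology from most
    of the argument.  The distance between a cone [C] and [L + c] vanishes
    exactly when [c] lies in the closure of [C + L] ([dist_gt0P]), and
    [C] meets [L + c] exactly when [c] lies in [C + L].  So strong
    infeasibility means [c \notin closure (C + L)], weak status means
    [c \in closure (C + L)] without strong feasibility, and weak feasibility
    means the same with [C + L] instead of its closure.  The relative interior
    of a convex cone is the set [acore] of points from which one can move a
    little backwards along every direction of the cone ([relint_cone]); unlike
    the topological definition, this one is computed block by block
    ([product_acore]).

    The second is that a single relaxation of [K] by [d] changes neither strong
    feasibility nor the closure of [K + L].  Every point [x] of the relative
    interior of the relaxed cone is pushed into that of [K] by a large multiple
    of [d] ([relaxation_absorbs]): for a block of [d] inside the Lorentz cone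
    because interior points absorb all vectors, and for a block [a] on the
    boundary because the Lorentz form (the square of the first entry minus the
    sum of the squares of the others) of [x + t a] grows like [2 t (a', x)],
    where the pairing of [x] with the reflection [a'] of [a] is positive.  As
    [d] belongs to [L], the translation by [t d] preserves [L + c].  A point of
    the relaxed cone that is not interior is first perturbed into the interior,
    and this is why only the closure of [K + L] is preserved.

    The third is that [K + L] is closed for the last cone of a maximal
    sequence, so that weak infeasibility cannot occur there.  Maximality says
    that the elements of [K] and [L] in common vanish on all Lorentz blocks
    ([lorentz_blocks_vanish]).  Split [K] as [P + Z], where [Z] collects the
    Lorentz blocks and [P] all the others.  Then [P + L] is polyhedral, hence
    closed: adding a ray to a finite intersection of half-spaces is an instance
    of Fourier-Motzkin elimination ([halfspaces_msum_half_line]).  And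
    [Z + (P + L)] is closed because [Z] and [- (P + L)] have only [0] in common
    ([msum_cone_closed]). *)

(** * Convex cones and their algebraic core *)

Section Cones.
Context {R : realType} {V : lmodType R}.
Implicit Types (C D : set V) (x y d : V).

Definition convex_cone C : Prop :=
  [/\ C 0, forall x y, C x -> C y -> C (x + y)
    & forall (t : R) x, 0 <= t -> C x -> C (t *: x)].

(** The points [x] of [C] whose segments from [y \in C] can all be prolonged
    beyond [x] inside [C]; for a cone this prolongation can be written [x - t
    *: y]. *)
Definition acore C : set V :=
  [set x | C x /\ forall y, C y -> exists2 t : R, 0 < t & C (x - t *: y)].

Definition msum C D : set V := [set x + y | x in C & y in D].

(** For a convex cone [C] this is the linear span of [C]. *)
Definition differences C : set V :=
  [set x | exists u v, [/\ C u, C v & x = u - v]].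

Lemma differences_linear C (t : R) x y : convex_cone C ->
  differences C x -> differences C y -> differences C (t *: x + y).
Proof.
move=> [_ CD CZ] [u [v [Cu Cv ->]]] [a [b [Ca Cb ->]]].
have [t0|/ltW t0] := leP 0 t.
  exists (t *: u + a), (t *: v + b); split; [| |by rewrite scalerBr opprD addrACA].
    by apply: CD => //; apply: CZ.
  by apply: CD => //; apply: CZ.
have Nt0 : 0 <= - t by rewrite oppr_ge0.
exists ((- t) *: v + a), ((- t) *: u + b); split.
- by apply: CD => //; apply: CZ.
- by apply: CD => //; apply: CZ.
- rewrite !scaleNr scalerBr opprD opprK.
  by rewrite [RHS]addrACA [- _ + _]addrC.
Qed.

Lemma acore_add C x y : convex_cone C -> acore C x -> C y -> acore C (x + y).
Proof.
move=> [_ CD _] [Cx xC] Cy; split=> [|z Cz]; first exact: CD.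
have [t t0 Cxz] := xC z Cz; exists t => //.
by rewrite addrAC; apply: CD.
Qed.

Lemma acore_scale C x (t : R) :
  convex_cone C -> 0 < t -> acore C x -> acore C (t *: x).
Proof.
move=> [_ _ CZ] t0 [Cx xC]; split=> [|z Cz]; first by apply: CZ => //; exact: ltW.
have [s s0 Cxz] := xC z Cz; exists (t * s); first exact: mulr_gt0.
by rewrite -scalerA -scalerBr; apply: CZ => //; exact: ltW.
Qed.

(** The point [x - s *: y] lies on the segment from [x] to [x - t *: y]. *)
Lemma cone_shrink C x y (s t : R) : convex_cone C ->
  C x -> 0 <= s <= t -> 0 < t -> C (x - t *: y) -> C (x - s *: y).
Proof.
move=> [_ CD CZ] Cx /andP[s0 st] t0 Cxy.
have -> : x - s *: y = (1 - s / t) *: x + (s / t) *: (x - t *: y).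
  rewrite scalerBl scale1r scalerBr scalerA mulfVK ?gt_eqF//.
  by rewrite addrA subrK.
apply: CD; apply: CZ => //; last by rewrite divr_ge0// ltW.
by rewrite subr_ge0 ler_pdivrMr// mul1r.
Qed.

(** Write [x = u - v] with [u] and [v] in [C]: a multiple of [d] compensates
    [- v], and one more copy of [d] moves the result into the core. *)
Lemma acore_absorbs C d x : convex_cone C -> differences C = setT ->
  acore C d -> exists2 t : R, 0 <= t & acore C (x + t *: d).
Proof.
move=> Ccone Cgen [Cd dC]; have [_ CD CZ] := Ccone.
have : differences C x by rewrite Cgen.
move=> [u [v [Cu Cv ->]]].
have [s s0 Csd] := dC v Cv; exists (s^-1 + 1).
  by rewrite addr_ge0// invr_ge0 ltW.
rewrite scalerDl scale1r addrA addrC; apply: acore_add => //.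
rewrite -addrA; apply: CD => //.
have -> : - v + s^-1 *: d = s^-1 *: (d - s *: v).
  by rewrite scalerBr scalerA mulVf ?gt_eqF// scale1r addrC.
by apply: CZ => //; rewrite invr_ge0 ltW.
Qed.

(** To move from [x] against [y = u - v] it suffices to move against [u],
    since adding multiples of [v] stays in [D]. For cones with different spans
    the inclusion can fail, as for a ray on the boundary of a half-plane. *)
Lemma sub_acore C D : convex_cone C -> C `<=` D -> convex_cone D ->
  D `<=` differences C -> acore C `<=` acore D.
Proof.
move=> [_ _ CZ] CsD [_ DD _] Cgen x [Cx xC]; split=> [|y /Cgen]; first exact: CsD.
move=> [u [v [Cu Cv ->]]]; have [t t0 Cxu] := xC u Cu; exists t => //.
rewrite scalerBr opprB addrA addrAC.
by apply: DD; apply: CsD => //; apply: CZ => //; exact: ltW.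
Qed.

End Cones.

(** * The relative interior of a convex cone *)

Section RelativeInterior.
Context {R : realType}.

(** A subspace of maximal dimension inside [S] exhausts [S]. *)
Lemma subspace_vspace (V : vectType R) (S : set V) : S 0 ->
  (forall (t : R) x y, S x -> S y -> S (t *: x + y)) ->
  exists U : {vspace V}, forall x, S x <-> x \in U.
Proof.
move=> S0 SL.
pose P k := `[< exists U : {vspace V}, \dim U = k /\ forall x, x \in U -> S x >].
have exP : exists k, P k.
  exists 0%N; apply/asboolP; exists 0%VS; split; first exact: dimv0.
  by move=> x; rewrite memv0 => /eqP ->.
have ubP k : P k -> (k <= \dim {:V})%N.
  by move=> /asboolP[U [<- _]]; apply: dimvS; exact: subvf.
case: (ex_maxnP exP ubP) => k /asboolP[U [dimU US]] maxk.
exists U => x; split; last exact: US.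
move=> Sx.
have /maxk : P (\dim (<[x]> + U)%VS).
  apply/asboolP; exists (<[x]> + U)%VS; split=> // y.
  by move=> /memv_addP[_ /vlineP[t ->] [z /US Sz ->]]; apply: SL.
rewrite -dimU => le_dim.
suff -> : U = (<[x]> + U)%VS by rewrite (subvP (addvSl _ _)) ?memv_line.
by apply/eqP; rewrite eqEdim addvSr.
Qed.

Section Vectors.
Context {n : nat}.
Implicit Types (C : set 'rV[R]_n) (x y : 'rV[R]_n).

Lemma entry_norm_le x i : `|x 0 i| <= `|x|.
Proof.
rewrite [leRHS]/Num.norm /= mx_normrE.
exact: (le_bigmax _ (fun ij : 'I_1 * 'I_n => `|x ij.1 ij.2|) (0, i)).
Qed.

Lemma affine_hull_cone C : convex_cone C ->
  affine_hull C `<=` differences C.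
Proof.
move=> Ccone; have [C0 _ _] := Ccone; apply: smallest_sub; last first.
  by move=> x Cx; exists x, 0; rewrite subr0.
move=> x y t Cx Cy; apply: differences_linear => //.
by rewrite -[_ *: y]addr0; apply: differences_linear => //; exists 0, 0; rewrite subr0.
Qed.

(** From left to right, the backward step from [x] against [y] is a point of
    the affine hull close to [x], rescaled. From right to left, let [u_j -
    v_j] be the projection of the [j]-th basis vector on the span of [C]. Some
    [x - t *: \sum_j (u_j + v_j)] lies in [C], and a point [y] of the hull
    with all coordinates of [y - x] below [t] is obtained from it by adding
    nonnegative combinations of the [u_j] and [v_j]. *)
Lemma relint_cone C : convex_cone C -> relint C = acore C.
Proof.
move=> Ccone; have [C0 CD CZ] := Ccone.
apply/seteqP; split=> x.
  move=> [Hx nearC]; have Cx : C x by exact: (nbhs_singleton nearC).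
  split=> // y Cy; move: nearC => /nbhs_ballP[e /= e0 eC].
  have k0 : 0 < `|x - y| + 1 by rewrite ltr_wpDl.
  pose t := e / (`|x - y| + 1).
  have t0 : 0 < t by rewrite divr_gt0.
  have : C ((1 + t) *: x + (1 - (1 + t)) *: y).
    apply: eC; last first.
      by move=> A [affA CA]; apply: affA; apply: CA.
    rewrite -ball_normE /ball_ /=.
    have -> : x - ((1 + t) *: x + (1 - (1 + t)) *: y) = - (t *: (x - y)).
      by apply/rowP => i; rewrite !mxE; ring.
    rewrite normrN normrZ gtr0_norm// /t -mulrA gtr_pMr//.
    by rewrite mulrC ltr_pdivrMr// mul1r ltrDl.
  have -> : 1 - (1 + t) = - t by lra.
  move=> Ct; exists ((1 + t)^-1 * t); first by rewrite mulr_gt0// invr_gt0; lra.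
  have -> : x - ((1 + t)^-1 * t) *: y = (1 + t)^-1 *: ((1 + t) *: x + - t *: y).
    by rewrite scalerDr !scalerA mulVf ?scale1r ?mulrN ?scaleNr//; apply/eqP; lra.
  by apply: CZ => //; rewrite invr_ge0; lra.
move=> [Cx xC].
pose S := differences C.
have SL t a b : S a -> S b -> S (t *: a + b) by exact: differences_linear.
have S0 : S 0 by exists 0, 0; rewrite subr0.
have [U SU] := subspace_vspace S0 SL.
have pi_uv (j : 'I_n) : exists uv : 'rV[R]_n * 'rV[R]_n,
    [/\ C uv.1, C uv.2 & projv U (delta_mx 0 j) = uv.1 - uv.2].
  have /SU[u [v ?]] := memv_proj U (delta_mx 0 j : 'rV[R]_n).
  by exists (u, v).
have [f fP] := choice pi_uv.
have [t t0 Ct] : exists2 t : R, 0 < t & C (x - t *: \sum_j ((f j).1 + (f j).2)).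
  apply: xC; apply: (big_ind C C0 CD) => // j _; have [? ? _] := fP j; exact: CD.
split; first by move=> A [_]; exact.
apply/nbhs_ballP; exists t => //= y; rewrite -ball_normE /ball_ /= => xy.
move=> /(affine_hull_cone Ccone) Sy.
have yxU : y - x \in U.
  apply/SU; have -> : y - x = -1 *: x + y by rewrite scaleN1r addrC.
  by apply: SL => //; exists x, 0; rewrite subr0.
have -> : y = (x - t *: \sum_j ((f j).1 + (f j).2)) +
    \sum_j ((t + (y - x) 0 j) *: (f j).1 + (t - (y - x) 0 j) *: (f j).2).
  rewrite -{1}(subrK x y) addrC -addrA; congr (_ + _).
  rewrite -{1}(projv_id yxU) {1}[y - x]row_sum_delta linear_sum scaler_sumr.
  rewrite addrC -sumrB; apply: eq_bigr => j _; have [_ _ fj] := fP j.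
  rewrite linearZ /= fj; move: ((y - x) 0 j) => a.
  move: (f j).1 => u; move: (f j).2 => v.
  by apply/rowP => k; rewrite !mxE; ring.
apply: (CD) => //; apply: (big_ind C C0 CD) => j _; have [Cu Cv _] := fP j.
have := le_lt_trans (entry_norm_le (x - y) j) xy.
rewrite !mxE ltr_norml => /andP[? ?].
by apply: CD; apply: CZ => //; lra.
Qed.

End Vectors.
End RelativeInterior.

(** * Closed sums of cones *)

Section ClosedSums.
Context {R : realType} {n : nat}.
Implicit Types (C D : set 'rV[R]_n) (x y : 'rV[R]_n).

Lemma closureP C x :
  closure C x <-> forall e : R, 0 < e -> exists2 y, C y & `|x - y| < e.
Proof.
split=> [Cx e e0|Cx B /nbhs_ballP[e /= e0 eB]].
  have [y [Cy xy]] := Cx _ (nbhsx_ballx x e e0).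
  by exists y => //; move: xy; rewrite -ball_normE.
have [y Cy xy] := Cx e e0.
by exists y; split=> //; apply: eB; rewrite -ball_normE.
Qed.

(** If [c_e + d_e] tends to [x], the [c_e] cluster at some [c] of the compact
    set, and then [x - c] is adherent to [D]. *)
Lemma msum_compact_closed C D : compact C -> closed D -> closed (msum C D).
Proof.
move=> Cco Dcl x /closureP Sx.
pose B (e : R) := [set c | C c /\ exists2 d, D d & `|x - (c + d)| < e].
pose F := filter_from [set e : R | 0 < e] B.
have FF : ProperFilter F.
  apply: filter_from_proper; last first.
    move=> e /= e0; have [_ [c Cc [d Dd <-]] xcd] := Sx e e0.
    by exists c; split=> //; exists d.
  apply: filter_from_filter; first by exists 1; rewrite /= ltr01.
  move=> e f /= e0 f0; exists (Num.min e f); first by rewrite /= lt_min e0.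
  by move=> c [Cc [d Dd]]; rewrite lt_min => /andP[? ?]; split; split=> //; exists d.
have [c [Cc Fc]] : C `&` cluster F !=set0.
  by apply: Cco; exists 1 => /=; [exact: ltr01|move=> c []].
exists c => //; exists (x - c); last by rewrite addrC subrK.
apply: Dcl; apply/closureP => e e0.
have e20 : 0 < e / 2 by rewrite divr_gt0.
have [c' [[Cc' [d Dd xcd]]]] : B (e / 2) `&` ball c (e / 2) !=set0.
  by apply: Fc; [exists (e / 2)|exact: nbhsx_ballx].
rewrite -ball_normE /ball_ /= => cc'; exists d => //.
have -> : x - c - d = (x - (c' + d)) - (c - c').
  by apply/rowP => i; rewrite !mxE; ring.
by rewrite (le_lt_trans (ler_normB _ _))//; lra.
Qed.

Lemma norm_ball_compact C (r : R) :
  closed C -> compact (C `&` [set x | `|x| <= r]).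
Proof.
move=> Ccl; apply: bounded_closed_compact.
  exists r; split; first exact: num_real.
  by move=> s rs x [_ /= xr]; rewrite (le_trans xr)// ltW.
apply: closedI => //.
exact: (closed_comp (fun x _ => @norm_continuous _ _ x) (@closed_le R r)).
Qed.

Lemma unit_sphere_compact C : closed C -> compact (C `&` [set x | `|x| = 1]).
Proof.
move=> Ccl; apply: (@subclosed_compact _ _ (C `&` [set x | `|x| <= 1])).
- apply: closedI => //.
  exact: (closed_comp (fun x _ => @norm_continuous _ _ x) (@closed_eq R 1)).
- exact: norm_ball_compact.
- by move=> x [Cx /= ->].
Qed.

(** On the unit sphere of [C], which is compact, the distance to [- D] has a
    positive lower bound [e]. By homogeneity [e * `|c| <= `|c + d|] for all
    [c] and [d], so near a given point only a bounded part of [C] contributes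
    to [C + D]. *)
Lemma msum_cone_closed C D : convex_cone C -> convex_cone D ->
  closed C -> closed D -> (forall x, C x -> D (- x) -> x = 0) ->
  closed (msum C D).
Proof.
move=> [_ _ CZ] [_ _ DZ] Ccl Dcl CD0.
have [e e0 He] : exists2 e : R, 0 < e &
    forall c d, C c -> D d -> e * `|c| <= `|c + d|.
  pose S := C `&` [set x | `|x| = 1].
  have Scl : closed (msum S D).
    by apply: msum_compact_closed => //; exact: unit_sphere_compact.
  have : ~ closure (msum S D) 0.
    move=> /Scl[c [Cc /= c1] [d Dd cd0]].
    have dE : d = - c by apply/eqP; rewrite -addr_eq0 addrC cd0.
    have c0 : c = 0 by apply: CD0; rewrite // -dE.
    by move: c1 => /eqP; rewrite c0 normr0 eq_sym oner_eq0.
  move=> /closureP/existsNP[e /not_implyP[e0 He]]; exists e => // c d Cc Dd.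
  have [->|c0] := eqVneq c 0; first by rewrite normr0 mulr0.
  have nc0 : 0 < `|c| by rewrite normr_gt0.
  rewrite leNgt; apply/negP => lt_cd; apply: He.
  exists (`|c|^-1 *: c + `|c|^-1 *: d).
    exists (`|c|^-1 *: c).
      split; first by apply: CZ; rewrite ?invr_ge0// ltW.
      by rewrite /= normrZ normfV normr_id mulVf// gt_eqF.
    by exists (`|c|^-1 *: d) => //; apply: DZ; rewrite ?invr_ge0// ltW.
  by rewrite sub0r normrN -scalerDr normrZ normfV normr_id mulrC ltr_pdivrMr.
move=> x /closureP CDx.
(* Approximations within 1 of x have norm at most `|x| + 1. *)
pose r := (`|x| + 1) / e.
suff [c [Cc _] [d Dd <-]] : msum (C `&` [set x | `|x| <= r]) D x.
  by exists c => //; exists d.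
apply: (msum_compact_closed (norm_ball_compact Ccl) Dcl).
apply/closureP => f f0.
have [_ [c Cc [d Dd <-]]] : exists2 y, msum C D y & `|x - y| < Num.min f 1.
  by apply: CDx; rewrite lt_min f0 ltr01.
rewrite lt_min => /andP[xf x1]; exists (c + d) => //.
exists c; last by exists d.
split=> //=; rewrite ler_pdivlMr// mulrC (le_trans (He _ _ Cc Dd))//.
have -> : c + d = x - (x - (c + d)) by rewrite subKr.
by rewrite (le_trans (ler_normB _ _))// lerD2l ltW.
Qed.

End ClosedSums.

(** * Polyhedral cones and Fourier-Motzkin elimination *)

Section Polyhedral.
Context {R : realType}.

(** The least [t] compatible with finitely many lower bounds, one of them [0]:
    knowing which bound is attained is what the elimination below needs. *)
Lemma seq_max_nneg (T : eqType) (s : seq T) (l : T -> R) :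
  exists t : R, [/\ 0 <= t, forall a, a \in s -> l a <= t
    & t = 0 \/ exists2 a, a \in s & t = l a].
Proof.
elim: s => [|b s [t [t0 st tE]]]; first by exists 0; split=> //; left.
have [bt|/ltW tb] := leP (l b) t.
  exists t; split=> //; first by move=> a; rewrite inE => /predU1P[->//|/st].
  by case: tE => [|[a sa ->]]; [left|right; exists a; rewrite // inE sa orbT].
exists (l b); split; first exact: le_trans tb.
  by move=> a; rewrite inE => /predU1P[->//|/st /le_trans]; exact.
by right; exists b; rewrite // mem_head.
Qed.

Section FixedDim.
Context {n : nat}.
Implicit Types (x y v : 'rV[R]_n) (a b : 'cV[R]_n) (s : seq 'cV[R]_n).
Implicit Types (P : set 'rV[R]_n).

Definition halfspaces s : set 'rV[R]_n :=
  [set x | forall a, a \in s -> 0 <= (x *m a) 0 0].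

Definition polyhedral P : Prop := exists s, P = halfspaces s.

(** Eliminating [t] from the constraints [t * (v *m a) <= x *m a]: those where
    [v *m a] is nonnegative must hold at [t = 0], and each upper bound on [t]
    is combined with each lower bound. *)
Definition fourier_motzkin s v : seq 'cV[R]_n :=
  [seq a <- s | 0 <= (v *m a) 0 0] ++
  [seq (v *m a) 0 0 *: b - (v *m b) 0 0 *: a
    | a <- [seq a <- s | 0 < (v *m a) 0 0], b <- [seq b <- s | (v *m b) 0 0 < 0]].

Lemma formDZ x v a (t : R) :
  ((x + t *: v) *m a) 0 0 = (x *m a) 0 0 + t * (v *m a) 0 0.
Proof. by rewrite mulmxDl -scalemxAl !mxE. Qed.

Lemma formBZ x a b (t r : R) :
  (x *m (t *: b - r *: a)) 0 0 = t * (x *m b) 0 0 - r * (x *m a) 0 0.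
Proof. by rewrite mulmxBr -!scalemxAr !mxE. Qed.

(** Given [x] subject to the eliminated constraints, take for [t] the largest
    of [0] and all the lower bounds, so that the paired constraint with the
    bound where [t] is attained gives every upper bound. *)
Lemma halfspaces_msum_half_line s v :
  msum (halfspaces s) (half_line v) = halfspaces (fourier_motzkin s v).
Proof.
apply/seteqP; split=> x.
  move=> [y sy [_ [t t0 ->] <-]] c; rewrite mem_cat => /orP[|].
    rewrite mem_filter => /andP[vc /sy yc].
    by rewrite formDZ addr_ge0// mulr_ge0.
  move=> /allpairsP[[a b] /= []]; rewrite !mem_filter.
  move=> /andP[va /sy ya] /andP[vb /sy yb] ->.
  rewrite formBZ !formDZ.
  move: ya yb va vb; move: ((v *m a) 0 0) => va; move: ((v *m b) 0 0) => vb.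
  move: ((y *m a) 0 0) => ya; move: ((y *m b) 0 0) => yb *.
  have -> : va * (yb + t * vb) - vb * (ya + t * va) = va * yb + - vb * ya by ring.
  by rewrite addr_ge0// mulr_ge0// ?oppr_ge0 ltW.
move=> sx.
pose neg := [seq b <- s | (v *m b) 0 0 < 0].
have [t [t0 tmax tE]] :=
  seq_max_nneg neg (fun b => (x *m b) 0 0 / (v *m b) 0 0).
exists (x + (- t) *: v); last first.
  by exists (t *: v); [exists t|rewrite scaleNr subrK].
move=> a sa; rewrite formDZ.
have [va|va|va] := ltgtP ((v *m a) 0 0) 0.
- have : a \in neg by rewrite mem_filter va.
  by move=> /tmax /=; rewrite mulNr subr_ge0 ler_ndivrMr.
- have xa : 0 <= (x *m a) 0 0 by apply: sx; rewrite mem_cat mem_filter (ltW va) sa.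
  case: tE => [->|[b]]; first by rewrite oppr0 mul0r addr0.
  rewrite mem_filter => /andP[vb sb ->].
  have : 0 <= (x *m ((v *m a) 0 0 *: b - (v *m b) 0 0 *: a)) 0 0.
    apply: sx; rewrite mem_cat; apply/orP; right; apply/allpairsP.
    by exists (a, b); split=> //=; rewrite mem_filter ?va ?vb.
  rewrite formBZ => ab; have vb' : 0 < - (v *m b) 0 0 by rewrite oppr_gt0.
  rewrite -(pmulr_rge0 _ vb'); congr (0 <= _): ab; field.
  by rewrite lt_eqF.
- rewrite va mulr0 addr0.
  by apply: sx; rewrite mem_cat mem_filter va lexx sa.
Qed.

Lemma polyhedral_msum_half_line P v :
  polyhedral P -> polyhedral (msum P (half_line v)).
Proof.
by move=> [s ->]; exists (fourier_motzkin s v); exact: halfspaces_msum_half_line.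
Qed.

(** A subspace is the sum of the rays spanned by the vectors of a basis and
    their opposites. *)
Lemma polyhedral_msum_subspace P (L : {vspace 'rV[R]_n}) :
  polyhedral P -> polyhedral (msum P [set` L]).
Proof.
rewrite -(span_basis (vbasisP L)); move: (vbasis L : seq _) => X.
elim: X P => [|v X IH] P Ppoly.
  suff -> : msum P [set` <<[::]>>%VS] = P by [].
  apply/seteqP; split=> x.
    by move=> [y Py [z /=]]; rewrite span_nil memv0 => /eqP-> <-; rewrite addr0.
  by move=> Px; exists x => //; exists 0; rewrite ?addr0//= mem0v.
suff -> : msum P [set` <<v :: X>>%VS] =
    msum (msum (msum P (half_line v)) (half_line (- v))) [set` <<X>>%VS].
  by apply: IH; do 2 apply: polyhedral_msum_half_line.
apply/seteqP; split=> x.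
  move=> [y Py [z /=]]; rewrite span_cons => /memv_addP[_ /vlineP[t ->] [w Xw ->]] <-.
  exists (y + t *: v); last by exists w; rewrite // addrA.
  have [t0|/ltW t0] := leP 0 t.
    exists (y + t *: v); last by exists 0; [exists 0; rewrite ?scale0r|rewrite addr0].
    by exists y => //; exists (t *: v) => //; exists t.
  exists y; first by exists y => //; exists 0; [exists 0; rewrite ?scale0r|rewrite addr0].
  by exists (t *: v) => //; exists (- t); rewrite ?oppr_ge0// scaleNr scalerN opprK.
move=> [_ [_ [y Py [_ [t t0 ->] <-]] [_ [r r0 ->] <-]] [w Xw <-]].
exists y => //; exists ((t - r) *: v + w).
  by rewrite /= span_cons memv_add// memvZ// memv_line.
by rewrite !addrA scalerBl scalerN addrA.
Qed.

Lemma form_continuous a : continuous (fun x : 'rV[R]_n => (x *m a) 0 0).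
Proof.
have -> : (fun x : 'rV[R]_n => (x *m a) 0 0) =
    (fun x => \sum_j x 0 j * a j 0) by apply/funext => x; rewrite mxE.
apply: (@continuous_big R _ +%R 0 xpredT (@add_continuous R) _ _
  (fun j (x : 'rV[R]_n) => x 0 j * a j 0)) => j _ x.
by apply: (@cvgMl _ _ _ (nbhs_filter x)); exact: coord_continuous.
Qed.

Lemma polyhedral_closed P : polyhedral P -> closed P.
Proof.
move=> [s ->].
have -> : halfspaces s =
    \bigcap_(a in [set` s]) [set x : 'rV[R]_n | 0 <= (x *m a) 0 0] by [].
apply: closed_bigI => a _.
exact: (closed_comp (fun x _ => @form_continuous a x) (@closed_ge R 0)).
Qed.

Lemma polyhedral_zero : polyhedral ([set 0] : set 'rV[R]_n).
Proof.
(* The coordinates and their opposites. *)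
exists ([seq delta_mx j 0 | j <- enum 'I_n] ++
        [seq - delta_mx j 0 | j <- enum 'I_n]).
have formE x j : (x *m (delta_mx j 0 : 'cV_n)) 0 0 = x 0 j.
  by rewrite -[_ *m _]colE mxE.
apply/seteqP; split=> x.
  by move=> -> a _; rewrite mul0mx mxE.
move=> sx; apply/rowP => j; apply/eqP; rewrite mxE eq_le; apply/andP; split.
  rewrite -oppr_ge0 -formE.
  suff : 0 <= (x *m - (delta_mx j 0 : 'cV_n)) 0 0 by rewrite mulmxN [X in 0 <= X]mxE.
  apply: sx; rewrite mem_cat; apply/orP; right.
  by apply/mapP; exists j; rewrite ?mem_enum.
rewrite -formE; apply: sx; rewrite mem_cat; apply/orP; left.
by apply/mapP; exists j; rewrite ?mem_enum.
Qed.

Lemma polyhedral_setT : polyhedral ([set: 'rV[R]_n]).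
Proof. by exists [::]; apply/seteqP; split. Qed.

Lemma polyhedral_half_space v : polyhedral (half_space v).
Proof.
have formE x : (x *m v^T) 0 0 = dot v x.
  by rewrite mxE; apply: eq_bigr => j _; rewrite mxE mulrC.
exists [:: v^T]; apply/seteqP; split=> x.
  by move=> vx a; rewrite inE => /eqP->; rewrite formE.
by move=> /(_ v^T); rewrite mem_head formE; exact.
Qed.

Lemma polyhedral_half_line v : polyhedral (half_line v).
Proof.
suff <- : msum [set 0] (half_line v) = half_line v.
  exact/polyhedral_msum_half_line/polyhedral_zero.
apply/seteqP; split=> x; first by move=> [_ -> [y vy <-]]; rewrite add0r.
by move=> vx; exists 0 => //; exists x; rewrite ?add0r.
Qed.

Lemma polyhedral_forall (q : nat) (P : 'I_q -> set 'rV[R]_n) :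
  (forall i, polyhedral (P i)) -> polyhedral [set x | forall i, P i x].
Proof.
move=> /choice[s Ps].
exists (flatten [seq s i | i <- enum 'I_q]); apply/seteqP; split=> x.
  move=> Px a /flatten_mapP[i _ sa].
  by move: (Px i); rewrite Ps; exact.
move=> sx i; rewrite Ps => a sa; apply: sx.
by apply/flatten_mapP; exists i; rewrite ?mem_enum.
Qed.

End FixedDim.

Lemma polyhedral_preimage (n k : nat) (B : 'M[R]_(n, k)) (P : set 'rV[R]_k) :
  polyhedral P -> polyhedral [set x | P (x *m B)].
Proof.
move=> [s ->]; exists [seq B *m a | a <- s]; apply/seteqP; split=> x.
  by move=> sx _ /mapP[a sa ->]; rewrite mulmxA; exact: sx.
by move=> sx a sa; rewrite /= -mulmxA; apply: sx; exact: map_f.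
Qed.

End Polyhedral.

(** * The Euclidean norm and the Lorentz cone *)

Section EuclideanNorm.
Context {R : realType} {n : nat}.
Implicit Types (x y : 'rV[R]_n).

Lemma dotC x y : dot x y = dot y x.
Proof. by apply: eq_bigr => i _; rewrite mulrC. Qed.

Lemma dotDr x y z : dot x (y + z) = dot x y + dot x z.
Proof. by rewrite -big_split; apply: eq_bigr => i _; rewrite mxE mulrDr. Qed.

Lemma dotZr (t : R) x y : dot x (t *: y) = t * dot x y.
Proof. by rewrite mulr_sumr; apply: eq_bigr => i _; rewrite mxE mulrCA. Qed.

Lemma dot_addZ (t : R) x y :
  dot (x + t *: y) (x + t *: y) = dot x x + 2 * t * dot y x + t ^+ 2 * dot y y.
Proof.
rewrite dotDr dotZr ![dot (_ + _) _]dotC !dotDr !dotZr (dotC x y); ring.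
Qed.

Lemma dot_ge0 x : 0 <= dot x x.
Proof. by apply: sumr_ge0 => i _; rewrite -expr2 sqr_ge0. Qed.

Lemma norm2E x : norm2 x = Num.sqrt (dot x x).
Proof. by congr Num.sqrt; apply: eq_bigr => i _; rewrite expr2. Qed.

Lemma norm2_ge0 x : 0 <= norm2 x.
Proof. exact: sqrtr_ge0. Qed.

Lemma sqr_norm2 x : norm2 x ^+ 2 = dot x x.
Proof. by rewrite norm2E sqr_sqrtr// dot_ge0. Qed.

Lemma dot_eq0 x : (dot x x == 0) = (x == 0).
Proof.
apply/eqP/eqP => [xx0|->]; last first.
  by apply: big1 => i _; rewrite mxE mul0r.
apply/rowP => i; rewrite mxE; apply/eqP; rewrite -sqrf_eq0 expr2.
have /psumr_eq0P -> // : forall j, j \in 'I_n -> 0 <= x 0 j * x 0 j.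
by move=> j _; rewrite -expr2 sqr_ge0.
Qed.

Lemma norm2_eq0 x : (norm2 x == 0) = (x == 0).
Proof. by rewrite -sqrf_eq0 sqr_norm2 dot_eq0. Qed.

Lemma norm2_0 : norm2 (0 : 'rV[R]_n) = 0.
Proof. by apply/eqP; rewrite norm2_eq0. Qed.

(** Cauchy-Schwarz, from the nonnegativity of the square of [norm2 y *: x -
    norm2 x *: y]. *)
Lemma dot_le_norm2 x y : dot x y <= norm2 x * norm2 y.
Proof.
have [->|x0] := eqVneq x 0.
  by rewrite norm2_0 mul0r dotC -(scale0r 0) dotZr mul0r.
have [->|y0] := eqVneq y 0.
  by rewrite norm2_0 mulr0 -(scale0r 0) dotZr mul0r.
have xy0 : 0 < norm2 x * norm2 y.
  by rewrite mulr_gt0// lt0r norm2_ge0 norm2_eq0 ?x0 ?y0.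
have := dot_ge0 (norm2 y *: x + (- norm2 x) *: y).
rewrite !dotDr !dotZr ![dot (_ + _) _]dotC !dotDr !dotZr (dotC y x) -!sqr_norm2.
move: (dot x y) (norm2 x) (norm2 y) xy0 => d a b ab0.
have -> : b * (b * a ^+ 2 + - a * d) + - a * (b * d + - a * b ^+ 2) =
  2 * (a * b) * (a * b - d) by ring.
have ab2 : 0 < 2 * (a * b) by rewrite mulr_gt0.
by rewrite (pmulr_rge0 _ ab2) subr_ge0.
Qed.

Lemma norm2D x y : norm2 (x + y) <= norm2 x + norm2 y.
Proof.
rewrite -ler_sqr ?nnegrE ?addr_ge0 ?norm2_ge0//.
rewrite sqrrD !sqr_norm2 dotDr ![dot (_ + _) _]dotC !dotDr (dotC y x).
by have := dot_le_norm2 x y; lra.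
Qed.

Lemma norm2Z (t : R) x : 0 <= t -> norm2 (t *: x) = t * norm2 x.
Proof.
move=> t0; rewrite !norm2E dotZr dotC dotZr mulrA sqrtrM ?mulr_ge0//.
by rewrite -expr2 sqrtr_sqr ger0_norm.
Qed.

Lemma norm_attained x : x != 0 -> exists i, `|x| = `|x 0 i|.
Proof.
move=> x0; have [|[i j] xij] := @mx_norm_neq0 _ _ _ x.
  by rewrite -[mx_norm _]/(`|x|) normr_eq0.
by exists j; rewrite [LHS]xij /= (ord1 i).
Qed.

Lemma norm_le_norm2 x : `|x| <= norm2 x.
Proof.
have [->|x0] := eqVneq x 0; first by rewrite normr0 norm2_0.
have [j ->] := norm_attained x0.
rewrite -sqrtr_sqr norm2E ler_wsqrtr//.
rewrite /dot (bigD1 j)//= -expr2 lerDl.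
by apply: sumr_ge0 => i _; rewrite -expr2 sqr_ge0.
Qed.

Lemma norm2_le_norm x : norm2 x <= n%:R * `|x|.
Proof.
rewrite -ler_sqr ?nnegrE ?mulr_ge0 ?norm2_ge0// sqr_norm2.
apply: (@le_trans _ _ (n%:R * `|x| ^+ 2)).
  rewrite -[n in n%:R]card_ord mulr_natl -sumr_const; apply: ler_sum => i _.
  by rewrite -expr2 -real_normK ?num_real// ler_sqr ?nnegrE// entry_norm_le.
rewrite exprMn ler_wpM2r ?sqr_ge0// -natrX ler_nat.
by case: (n) => // k; rewrite expnS leq_pmulr.
Qed.

End EuclideanNorm.

Section LorentzCone.
Context {R : realType} {k : nat}.
Implicit Types (a d x y : 'rV[R]_k.+1).

Lemma tailD x y : tail (x + y) = tail x + tail y.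
Proof. by apply/rowP => i; rewrite !mxE. Qed.

Lemma tailZ (t : R) x : tail (t *: x) = t *: tail x.
Proof. by apply/rowP => i; rewrite !mxE. Qed.

Lemma tail0 : tail (0 : 'rV[R]_k.+1) = 0.
Proof. by apply/rowP => i; rewrite !mxE. Qed.

(** The direction of the axis of the Lorentz cone, which serves as a witness
    of its nonempty interior. *)
Definition apex : 'rV[R]_k.+1 := delta_mx 0 0.

Lemma tail_apex : tail apex = 0.
Proof. by apply/rowP => i; rewrite !mxE. Qed.

Lemma apex0 : apex 0 0 = 1.
Proof. by rewrite !mxE. Qed.

Lemma lorentz_cone : convex_cone (lorentz : set 'rV[R]_k.+1).
Proof.
split=> [|x y|t x t0]; rewrite /lorentz/=.
- by rewrite tail0 norm2_0 mxE.
- rewrite tailD mxE => Cx Cy; exact: le_trans (norm2D _ _) (lerD Cx Cy).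
- by rewrite tailZ norm2Z// mxE => Cx; rewrite ler_wpM2l.
Qed.

Lemma apex_shift_lorentz x : lorentz (x + (norm2 (tail x) + `|x 0 0|) *: apex).
Proof.
rewrite /lorentz /= tailD tailZ tail_apex scaler0 addr0 !mxE/= mulr1.
by have := ler_norm (- x 0 0); rewrite normrN; lra.
Qed.

Lemma lorentz_differences : differences (lorentz : set 'rV[R]_k.+1) = setT.
Proof.
have [_ _ CZ] := lorentz_cone.
apply/seteqP; split=> // x _.
exists (x + (norm2 (tail x) + `|x 0 0|) *: apex).
exists ((norm2 (tail x) + `|x 0 0|) *: apex).
split; [exact: apex_shift_lorentz| |by rewrite addrK].
apply: CZ; first by rewrite addr_ge0// norm2_ge0.
by rewrite /lorentz/= tail_apex norm2_0 apex0.
Qed.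

(** Against [apex] the backward step forces strictness. Conversely a step
    proportional to the slack is admissible, because each side of the
    inequality changes by at most [y 0 0] per unit of step. *)
Lemma lorentz_acoreP x : acore lorentz x <-> norm2 (tail x) < x 0 0.
Proof.
split=> [[Cx xC]|Cx].
  have [|t t0] := xC apex; first by rewrite /lorentz/= tail_apex norm2_0 apex0.
  rewrite -scaleNr /lorentz/= tailD tailZ tail_apex scaler0 addr0 !mxE/=; lra.
split=> [|y Cy]; first exact: ltW.
have y0 : 0 <= y 0 0 by exact: le_trans (norm2_ge0 _) Cy.
have k0 : 0 < y 0 0 + y 0 0 + 1 by lra.
pose t := (x 0 0 - norm2 (tail x)) / (y 0 0 + y 0 0 + 1).
have t0 : 0 < t by rewrite divr_gt0// subr_gt0.
have tE : t * (y 0 0 + y 0 0 + 1) = x 0 0 - norm2 (tail x).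
  by rewrite mulfVK// gt_eqF.
exists t => //.
have NyC : norm2 (- tail y) <= y 0 0.
  suff -> : norm2 (- tail y) = norm2 (tail y) by [].
  by rewrite !norm2E -scaleN1r dotZr dotC dotZr mulrA mulrNN !mul1r.
rewrite /lorentz/= -scalerN tailD tailZ.
have -> : tail (- y) = - tail y by rewrite -scaleN1r tailZ scaleN1r.
apply: le_trans (norm2D _ _) _; rewrite norm2Z ?(ltW t0)// !mxE.
have : t * norm2 (- tail y) <= t * y 0 0 by rewrite ler_wpM2l// ltW.
by move: tE; lra.
Qed.

(** A point outside by [norm2 (tail x) - x 0 0] stays outside under
    perturbations of its entries that are small compared with this gap; the
    factor [k + 1] is the cost of the sup norm on [tail x] and on the first
    entry. *)
Lemma lorentz_closed : closed (lorentz : set 'rV[R]_k.+1).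
Proof.
move=> x /closureP Cx; rewrite /lorentz/= leNgt; apply/negP => xC.
pose m : R := k%:R + 1; have m0 : 0 < m by rewrite ltr_wpDl.
have [] := Cx ((norm2 (tail x) - x 0 0) / m); first by rewrite divr_gt0// subr_gt0.
move=> y Cy; rewrite ltr_pdivlMr// => xy.
have tail_le : norm2 (tail (x - y)) <= k%:R * `|x - y|.
  apply: le_trans (norm2_le_norm _) _; rewrite ler_wpM2l//.
  have [->|] := eqVneq (tail (x - y)) 0; first by rewrite normr0.
  by move=> /norm_attained[i ->]; rewrite mxE entry_norm_le.
have := norm2D (tail (x - y)) (tail y); rewrite -tailD subrK.
have := le_trans (ler_norm _) (entry_norm_le (y - x) 0); rewrite distrC !mxE.
move: Cy xy tail_le; rewrite /lorentz/= /m mulrDr mulr1 [_ * k%:R]mulrC.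
lra.
Qed.

End LorentzCone.

(** * Factors of extended second order cones *)

Section Factors.
Context {R : realType} {k : nat}.
Implicit Types (a d x y : 'rV[R]_k.+1) (C : set 'rV[R]_k.+1).

Lemma half_space_cone d : convex_cone (half_space d).
Proof.
split=> [|x y|t x t0]; rewrite /half_space/=.
- by rewrite dotC /dot big1// => i _; rewrite mxE mul0r.
- by rewrite dotDr => ? ?; rewrite addr_ge0.
- by rewrite dotZr => ?; rewrite mulr_ge0.
Qed.

Lemma half_line_cone d : convex_cone (half_line d).
Proof.
split=> [|_ _ [s s0 ->] [t t0 ->]|t _ t0 [s s0 ->]].
- by exists 0; rewrite ?scale0r.
- by exists (s + t); rewrite ?addr_ge0// scalerDl.
- by exists (t * s); rewrite ?mulr_ge0// scalerA.
Qed.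

Lemma zero_cone : convex_cone ([set 0] : set 'rV[R]_k.+1).
Proof.
by split=> [|x y -> ->|t x _ ->] //=; rewrite ?addr0 ?scaler0.
Qed.

Lemma esoc_factor_cone C : esoc_factor C -> convex_cone C.
Proof.
case=> [->|[->|[->|[[d _ ->]|[d _ ->]]]]].
- exact: zero_cone.
- by split.
- exact: lorentz_cone.
- exact: half_space_cone.
- exact: half_line_cone.
Qed.

Lemma half_space_acore d x :
  d != 0 -> acore (half_space d) x -> 0 < dot d x.
Proof.
move=> d0 [_ xC]; have dd : 0 < dot d d by rewrite lt0r dot_ge0 dot_eq0 d0.
have [|t t0] := xC d; first exact: dot_ge0.
rewrite /half_space/= -scaleNr dotDr dotZr mulNr subr_ge0.
by apply: lt_le_trans; rewrite mulr_gt0.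
Qed.

(** For a half-space or a half-line, the vector that defines it is such a
    point. *)
Lemma esoc_factor_acore C : esoc_factor C -> exists x, acore C x.
Proof.
case=> [->|[->|[->|[[d [_ /= /eqP d0] ->]|[d _ ->]]]]].
- by exists 0; split=> // y ->; exists 1; rewrite ?scaler0 ?subr0.
- by exists 0; split=> // y _; exists 1.
- by exists apex; apply/lorentz_acoreP; rewrite tail_apex norm2_0 apex0 ltr01.
- have dd : 0 < dot d d by rewrite lt0r dot_ge0 dot_eq0 d0.
  exists d; split=> [|y dy]; first exact: ltW.
  have dy1 : 0 < dot d y + 1 by rewrite ltr_wpDl.
  exists (dot d d / (dot d y + 1)); first by rewrite divr_gt0.
  rewrite /half_space/= -scaleNr dotDr dotZr mulNr subr_ge0 mulrAC.
  by rewrite ler_pdivrMr// ler_pM2l// lerDl.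
- exists d; split=> [|_ [t t0 ->]]; first by exists 1; rewrite ?scale1r.
  have t1 : 0 < t + 1 by rewrite ltr_wpDl.
  exists (t + 1)^-1; first by rewrite invr_gt0.
  exists (1 - (t + 1)^-1 * t); last by rewrite scalerBl scale1r scalerA.
  by rewrite subr_ge0 mulrC ler_pdivrMr// mul1r lerDl.
Qed.

Lemma dot_reflection a x :
  dot (reflection a) x = a 0 0 * x 0 0 - dot (tail a) (tail x).
Proof.
rewrite /dot big_ord_recl mxE eqxx -sumrN; congr (_ + _).
by apply: eq_bigr => i _; rewrite !mxE /= mulNr.
Qed.

Lemma reflection_lorentz a : lorentz a -> lorentz (reflection a).
Proof.
rewrite /lorentz/= mxE eqxx; suff -> : tail (reflection a) = -1 *: tail a.
  by rewrite !norm2E dotZr dotC dotZr mulrA mulrNN !mul1r.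
by apply/rowP => i; rewrite !mxE mulN1r.
Qed.

Lemma dot_tail_split x y : dot x y = x 0 0 * y 0 0 + dot (tail x) (tail y).
Proof.
by rewrite /dot big_ord_recl; congr (_ + _); apply: eq_bigr => i _; rewrite !mxE.
Qed.

(** The Lorentz cone is self-dual up to reflection: this is Cauchy-Schwarz. *)
Lemma lorentz_sub_half_space a :
  lorentz a -> lorentz `<=` half_space (reflection a).
Proof.
move=> aC x xC; rewrite /half_space/= dot_reflection subr_ge0.
apply: le_trans (dot_le_norm2 _ _) _.
by apply: ler_pM => //; exact: norm2_ge0.
Qed.

(** As [a] is isotropic, the Lorentz form of [x + t *: a] is that of [x] plus
    [2 * t * dot (reflection a) x], which becomes positive for large [t], and
    so does its first entry. *)
Lemma boundary_absorbs a x : norm2 (tail a) = a 0 0 -> a 0 0 != 0 ->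
  0 < dot (reflection a) x -> exists2 t : R, 0 <= t & acore lorentz (x + t *: a).
Proof.
move=> aE a0; rewrite dot_reflection => g0.
have {}a0 : 0 < a 0 0 by rewrite lt0r a0 -aE norm2_ge0.
have aa : dot (tail a) (tail a) = a 0 0 ^+ 2 by rewrite -sqr_norm2 aE.
pose g := a 0 0 * x 0 0 - dot (tail a) (tail x).
have {}g0 : 0 < g by [].
(* t1 makes the Lorentz form positive, t2 the first entry. *)
pose t1 := (`|dot (tail x) (tail x) - x 0 0 ^+ 2| + 1) / g.
pose t2 := (`|x 0 0| + 1) / a 0 0.
have t10 : 0 < t1 by rewrite divr_gt0// ltr_wpDl.
have t20 : 0 < t2 by rewrite divr_gt0// ltr_wpDl.
have t1E : t1 * g = `|dot (tail x) (tail x) - x 0 0 ^+ 2| + 1.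
  by rewrite mulfVK// gt_eqF.
have t2E : t2 * a 0 0 = `|x 0 0| + 1 by rewrite mulfVK// gt_eqF.
exists (t1 + t2); first by rewrite addr_ge0 ?ltW.
have x0 : 0 < (x + (t1 + t2) *: a) 0 0.
  rewrite !mxE mulrDl t2E.
  have : 0 < t1 * a 0 0 by rewrite mulr_gt0.
  by have := ler_norm (- x 0 0); rewrite normrN; lra.
apply/lorentz_acoreP.
rewrite -ltr_sqr ?nnegrE ?norm2_ge0 ?(ltW x0)// sqr_norm2 tailD tailZ !mxE.
rewrite dot_addZ aa.
have t2g : 0 < t2 * g by rewrite mulr_gt0.
have t1g : 0 < t1 * g by rewrite mulr_gt0.
have := ler_norm (dot (tail x) (tail x) - x 0 0 ^+ 2).
move: t1g t1E t2g; rewrite /g.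
move: (`|_ - _|) => N; move: (dot (tail a) (tail x)) => w.
move: (dot (tail x) (tail x)) => u t1g t1E t2g uN; rewrite -subr_gt0.
have -> : (x 0 0 + (t1 + t2) * a 0 0) ^+ 2 -
    (u + 2 * (t1 + t2) * w + (t1 + t2) ^+ 2 * a 0 0 ^+ 2) =
  x 0 0 ^+ 2 - u + 2 * (t1 * (a 0 0 * x 0 0 - w)) +
  2 * (t2 * (a 0 0 * x 0 0 - w)) by ring.
by move: t1g; rewrite t1E; lra.
Qed.

End Factors.

(** * Feasibility statuses in terms of the sum with the subspace *)

Section FeasibilityStatus.
Context {R : realType} {n : nat}.
Variables (L : {vspace 'rV[R]_n}) (c : 'rV[R]_n).
Implicit Types (C D : set 'rV[R]_n).

Lemma feasibleP C : C `&` translate L c !=set0 <-> msum C [set` L] c.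
Proof.
split=> [[y [Cy [l Ll yE]]]|[x Cx [l Ll <-]]].
  rewrite -{}yE in Cy; exists (l + c) => //; exists (- l); first by rewrite /= rpredN.
  by rewrite addrAC subrr add0r.
exists x; split=> //; exists (- l); first by rewrite /= rpredN.
by rewrite addrCA addNr addr0.
Qed.

Lemma dist_ge0 (A B : set 'rV[R]_n) : (0 <= dist A B)%E.
Proof.
by apply: le_ereal_inf_tmp => z [x _ [y _ <-]]; rewrite lee_fin norm2_ge0.
Qed.

(** The vectors [x - (l + c)] and [(x - l) - c] agree, and the Euclidean and
    sup norms are equivalent. *)
Lemma dist_gt0P C :
  (0 < dist C (translate L c))%E <-> ~ closure (msum C [set` L]) c.
Proof.
split.
  move=> + /closureP Cc; rewrite ltNge => /negP; apply.
  apply/lee_addgt0Pr => e e0; rewrite add0e.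
  have n0 : 0 < n%:R + 1 :> R by rewrite ltr_wpDl.
  have [|_ [x Cx [l Ll <-]]] := Cc (e / (n%:R + 1)); first by rewrite divr_gt0.
  rewrite ltr_pdivlMr// => xlc.
  apply: (@le_trans _ _ (norm2 (x - (- l + c)))%:E).
    apply: ereal_inf_lbound; exists x => //; exists (- l + c) => //.
    by exists (- l); rewrite //= rpredN.
  rewrite lee_fin (le_trans (norm2_le_norm _))//.
  have -> : `|x - (- l + c)| = `|c - (x + l)|.
    by rewrite distrC; congr `|_|; apply/rowP => i; rewrite !mxE; ring.
  move: xlc; rewrite mulrDr mulr1 mulrC; have := normr_ge0 (c - (x + l)); lra.
move=> Cc; rewrite ltNge; apply/negP => d0; apply: Cc; apply/closureP => e e0.
have : (dist C (translate L c) < e%:E)%E by rewrite (le_lt_trans d0)// lte_fin.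
move=> /ereal_inf_lt[_ [x Cx [_ [l Ll <-] <-]]]; rewrite lte_fin => xe.
exists (x - l); first by exists x => //; exists (- l); rewrite //= rpredN.
have -> : `|c - (x - l)| = `|x - (l + c)|.
  by rewrite distrC; congr `|_|; apply/rowP => i; rewrite !mxE; ring.
exact: le_lt_trans (norm_le_norm2 _) xe.
Qed.

Lemma strongly_infeasibleP C :
  strongly_infeasible C L c <-> ~ closure (msum C [set` L]) c.
Proof.
split=> [[_ /dist_gt0P]//|Cc]; split; last exact/dist_gt0P.
apply: contrapT => /eqP/set0P/feasibleP Cf; apply: Cc.
exact: subset_closure.
Qed.

Lemma weakly_feasibleP C :
  weakly_feasible C L c <-> ~ strongly_feasible C L c /\ msum C [set` L] c.
Proof.
rewrite -feasibleP; split=> [[fC sC]|[sC fC]]; split=> //.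
  by move=> /set0P/eqP.
by apply: contrapT => /eqP/set0P.
Qed.

Lemma strongly_feasible_msum C :
  strongly_feasible C L c -> msum C [set` L] c.
Proof.
move=> [x [Tx [hx /nbhs_singleton xC]]]; apply/feasibleP; exists x.
by split=> //; exact: xC.
Qed.

Lemma weak_statusP C : weak_status C L c <->
  ~ strongly_feasible C L c /\ closure (msum C [set` L]) c.
Proof.
split=> [[/weakly_feasibleP[sC fC]|[fC d0]]|[sC clC]].
- by split=> //; exact: subset_closure.
- split; first by move=> /strongly_feasible_msum/feasibleP/set0P/eqP.
  by apply: contrapT => /dist_gt0P; rewrite d0 ltxx.
have [fC|fC] := pselect (C `&` translate L c !=set0).
  by left; apply/weakly_feasibleP; split=> //; exact/feasibleP.
right; split; first by apply: contrapT => /eqP/set0P.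
apply/eqP; rewrite eq_le dist_ge0 andbT leNgt; apply/negP => /dist_gt0P.
exact.
Qed.

Section Relax.
Variables (C D : set 'rV[R]_n) (d : 'rV[R]_n).
Hypotheses (Ccone : convex_cone C) (Dcone : convex_cone D).
Hypotheses (CD : C `<=` D) (Ld : d \in L).
Hypothesis coreCD : acore C `<=` acore D.
Hypothesis absorb :
  forall x, acore D x -> exists2 t : R, 0 <= t & acore C (x + t *: d).

(** Moving along [d \in L] stays inside [L + c] and enters the interior of
    [C]. *)
Lemma strongly_feasible_relax :
  strongly_feasible C L c <-> strongly_feasible D L c.
Proof.
rewrite /strongly_feasible !relint_cone//; split=> [[x [Tx /coreCD Dx]]|].
  by exists x.
move=> [_ [[l Ll <-] /absorb[t t0 Cx]]].
exists (l + c + t *: d); split=> //; exists (l + t *: d); last by rewrite addrAC.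
by rewrite /= memvD// memvZ.
Qed.

(** A point [x] of [D] is perturbed by a small multiple of [w] to reach the
    core of [D], from where a translation along [d \in L] leads into [C]. *)
Lemma closure_relax : acore D !=set0 ->
  closure (msum C [set` L]) c <-> closure (msum D [set` L]) c.
Proof.
move=> [w Dw]; split=> /closureP clc; apply/closureP => e e0.
  have [_ [x Cx [l Ll <-]] xe] := clc e e0.
  by exists (x + l) => //; exists x; [exact: CD|exists l].
have e20 : 0 < e / 2 by rewrite divr_gt0.
have [_ [x Dx [l Ll <-]] xe] := clc (e / 2) e20.
have w0 : 0 < `|w| + 1 by rewrite ltr_wpDl.
pose s := e / 2 / (`|w| + 1); have s0 : 0 < s by rewrite divr_gt0.
have [t t0 [Cy _]] : exists2 t : R, 0 <= t & acore C (s *: w + x + t *: d).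
  by apply: absorb; apply: acore_add => //; exact: acore_scale.
exists (s *: w + x + l).
  exists (s *: w + x + t *: d) => //; exists (l - t *: d).
    by rewrite /= memvB// memvZ.
  by rewrite addrACA subrr addr0.
have -> : c - (s *: w + x + l) = (c - (x + l)) - s *: w.
  by apply/rowP => i; rewrite !mxE; ring.
apply: le_lt_trans (ler_normB _ _) _.
have : `|s *: w| <= e / 2.
  rewrite normrZ gtr0_norm// /s [leLHS]mulrAC ler_pdivrMr//.
  by rewrite ler_pM2l// lerDl.
lra.
Qed.

End Relax.
End FeasibilityStatus.

(** * Products of cones and their relaxations *)

Section ConeSums.
Context {R : realType} {V : vectType R}.

Lemma subspace_cone (L : {vspace V}) : convex_cone [set` L].
Proof.
split=> [|x y|t x _] /=; [exact: mem0v|exact: memvD|exact: memvZ].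
Qed.

Lemma msum_cone (C D : set V) :
  convex_cone C -> convex_cone D -> convex_cone (msum C D).
Proof.
move=> [C0 CD CZ] [D0 DD DZ]; split=> [|x y|t x t0].
- by exists 0 => //; exists 0 => //; rewrite addr0.
- move=> [a Ca [b Db <-]] [a' Ca' [b' Db' <-]].
  by exists (a + a'); [exact: CD|exists (b + b'); [exact: DD|rewrite addrACA]].
- move=> [a Ca [b Db <-]].
  by exists (t *: a); [exact: CZ|exists (t *: b); [exact: DZ|rewrite scalerDr]].
Qed.

End ConeSums.

Section Products.
Context {R : realType} {q : nat} {m : 'I_q -> nat}.
Local Notation space := ('rV[R]_(\sum_i (m i).+1)).
Implicit Types (K P Z : blocks R m) (x y d : space) (i : 'I_q).

Lemma blockE x i : block x i = x *m submxrow 1%:M i.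
Proof. by rewrite mul_submxrow mulmx1. Qed.

Lemma blockD x y i : block (x + y) i = block x i + block y i.
Proof. exact: submxrowD. Qed.

Lemma blockZ (t : R) x i : block (t *: x) i = t *: block x i.
Proof. by rewrite !blockE scalemxAl. Qed.

Lemma blockB x y i : block (x - y) i = block x i - block y i.
Proof. exact: submxrowB. Qed.

Lemma block0 i : block (0 : space) i = 0.
Proof. by rewrite blockE mul0mx. Qed.

Lemma block_inj x y : (forall i, block x i = block y i) -> x = y.
Proof. by move=> xy; apply/mxrowP. Qed.

Lemma mxrow_block (y : forall i, 'rV[R]_(m i).+1) i : block (\mxrow_j y j) i = y i.
Proof. exact: mxrowK. Qed.

Lemma norm_block_le x i : `|block x i| <= `|x|.
Proof.
have [->|] := eqVneq (block x i) 0; first by rewrite normr0.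
by move=> /norm_attained[j ->]; rewrite mxE entry_norm_le.
Qed.

Lemma product_cone K : (forall i, convex_cone (K i)) -> convex_cone (product K).
Proof.
move=> Kcone; split=> [i|x y Kx Ky i|t x t0 Kx i].
- by rewrite block0; have [] := Kcone i.
- by rewrite blockD; have [_ KD _] := Kcone i; exact: KD.
- by rewrite blockZ; have [_ _ KZ] := Kcone i; exact: KZ.
Qed.

Lemma product_closed K : (forall i, closed (K i)) -> closed (product K).
Proof.
move=> Kcl x /closureP Kx i; apply: Kcl; apply/closureP => e e0.
have [y Ky xy] := Kx e e0; exists (block y i) => //.
apply: le_lt_trans xy.
by rewrite -blockB; exact: norm_block_le.
Qed.

Lemma product_polyhedral K :
  (forall i, polyhedral (K i)) -> polyhedral (product K).
Proof.
move=> Kpoly.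
have -> : product K = [set x | forall i, K i (x *m submxrow 1%:M i)].
  by apply/seteqP; split=> x Kx i; [rewrite -blockE|rewrite blockE]; exact: Kx.
by apply: polyhedral_forall => i; exact: polyhedral_preimage.
Qed.

(** A ray of one factor is a ray of the product, by padding with zeros;
    conversely the smallest of the finitely many steps allowed in the factors
    works for all. *)
Lemma product_acore K x : (forall i, convex_cone (K i)) ->
  acore (product K) x <-> forall i, acore (K i) (block x i).
Proof.
move=> Kcone; split=> [[Kx xK] i|xK].
  split=> [|y Ky]; first exact: Kx.
  pose w : space := \mxrow_j dfwith (fun j => 0 : 'rV[R]_(m j).+1) i y j.
  have Kw : product K w.
    by move=> j; rewrite mxrow_block; case: dfwithP => // k _; have [] := Kcone k.
  have [t t0 /(_ i)] := xK w Kw.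
  rewrite blockB blockZ mxrow_block dfwithin.
  by exists t.
split=> [i|y Ky]; first by have [] := xK i.
have /choice[t tP] : forall i, exists t : R,
    0 < t /\ K i (block x i - t *: block y i).
  by move=> i; have [_ /(_ _ (Ky i))[t t0 ?]] := xK i; exists t.
exists (\big[Num.min/1]_i t i).
  by apply: lt_bigmin => // i _; have [] := tP i.
move=> i; have [ti0 Kti] := tP i; have [Kxi _] := xK i.
rewrite blockB blockZ.
apply: (cone_shrink (Kcone i) Kxi _ ti0 Kti).
rewrite bigmin_le andbT; apply/ltW/lt_bigmin => // j _.
by have [] := tP j.
Qed.

(** The sum of the multiples needed by the blocks is enough for each block. *)
Lemma product_absorbs K P d : (forall i, convex_cone (K i)) ->
  (forall i, convex_cone (P i)) -> product K d ->
  (forall i (x : 'rV[R]_(m i).+1), acore (P i) x ->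
    exists2 t : R, 0 <= t & acore (K i) (x + t *: block d i)) ->
  forall x, acore (product P) x ->
    exists2 t : R, 0 <= t & acore (product K) (x + t *: d).
Proof.
move=> Kcone Pcone Kd absorb x /product_acore Px.
have /choice[t tP] : forall i, exists t : R,
    0 <= t /\ acore (K i) (block x i + t *: block d i).
  by move=> i; have [t t0 ?] := absorb i _ (Px Pcone i); exists t.
exists (\sum_i t i); first by apply: sumr_ge0 => i _; have [] := tP i.
apply/product_acore => // i; have [_ Kti] := tP i.
rewrite blockD blockZ (bigD1 i)//= scalerDl addrA.
apply: acore_add => //; have [_ _ KZ] := Kcone i; apply: KZ => //.
by apply: sumr_ge0 => j _; have [] := tP j.
Qed.

End Products.

Section Relaxation.
Context {R : realType} {q : nat} {m : 'I_q -> nat}.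
Local Notation space := ('rV[R]_(\sum_i (m i).+1)).
Local Notation relax K d i := (@relaxation R q m K d i).
Implicit Types (K : blocks R m) (x d : space) (i : 'I_q) (L : {vspace space}).

Lemma lorentz_boundary (k : nat) (a : 'rV[R]_k.+1) : lorentz a ->
  ~ acore lorentz a -> norm2 (tail a) = a 0 0.
Proof.
move=> Ca aC; apply/eqP; rewrite eq_le (Ca : norm2 (tail a) <= a 0 0)/=.
by rewrite leNgt; apply/negP => /lorentz_acoreP.
Qed.

Lemma lorentz_eq0 (k : nat) (a : 'rV[R]_k.+1) : lorentz a -> a 0 0 = 0 -> a = 0.
Proof.
move=> Ca a0; apply/eqP; rewrite -dot_eq0 dot_tail_split a0 mul0r add0r.
have : norm2 (tail a) <= 0 by rewrite -a0.
by rewrite -sqr_norm2 sqrf_eq0 eq_le norm2_ge0 andbT.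
Qed.

Lemma reflection_neq0 (k : nat) (a : 'rV[R]_k.+1) :
  a 0 0 != 0 -> reflection a != 0.
Proof.
by apply: contraNneq => /rowP/(_ 0); rewrite !mxE eqxx => ->.
Qed.

(** The fate [D] of a factor [C] under relaxation by a block [a] of the cone;
    [h] tells whether the factor is relaxed at all. For [a] in the Lorentz
    cone, membership in the relative boundary amounts to [norm2 (tail a) = a 0
    0]. *)
Variant relaxation_spec (k : nat) (C D : set 'rV[R]_k.+1) (a : 'rV[R]_k.+1)
    (h : Prop) : Prop :=
| RelaxFull of C = lorentz & acore lorentz a & D = setT & h
| RelaxHalf of C = lorentz & norm2 (tail a) = a 0 0 & a 0 0 != 0
    & D = half_space (reflection a) & h
| RelaxSame of C = lorentz -> a = 0 & D = C & ~ h.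

Lemma relaxationP K d i : product K d ->
  relaxation_spec (K i) (relax K d i) (block d i) ((H1 d K `|` H2 d K) i).
Proof.
move=> Kd; rewrite /relaxation.
have lorE : relint lorentz (block d i) = acore lorentz (block d i).
  by rewrite relint_cone//; exact: lorentz_cone.
have [iH1|iH1] := boolP (i \in H1 d K).
  move: iH1; rewrite inE => /[dup] iH1 [Ki]; rewrite lorE => aC.
  by apply: RelaxFull => //; left.
have [iH2|iH2] := boolP (i \in H2 d K).
  move: iH2; rewrite inE => /[dup] iH2 [Ki [[_]]]; rewrite lorE => aC /eqP a0.
  have Ca : lorentz (block d i) by rewrite -Ki; exact: Kd.
  apply: RelaxHalf => //; last by right.
    exact: lorentz_boundary.
  by apply/eqP => /(lorentz_eq0 Ca) /eqP; rewrite (negbTE a0).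
move: iH1 iH2; rewrite !notin_setE => iH1 iH2.
apply: RelaxSame => // [Ki|[]//].
apply: contrapT => a0; apply: iH2; split=> //; split=> //; split.
  by apply: subset_closure; rewrite -Ki; exact: Kd.
by move=> aC; apply: iH1.
Qed.

Lemma relaxation_extended K d :
  extended_soc K -> product K d -> extended_soc (relaxation K d).
Proof.
move=> Ksoc Kd i; case: (@relaxationP _ d i Kd) => [_ _ -> _|Ki aE a0 -> _|_ -> _].
- by right; left.
- do 3 right; left; exists (reflection (block d i)) => //; split.
    by apply: reflection_lorentz; rewrite -Ki; exact: Kd.
  exact/eqP/reflection_neq0.
- exact: Ksoc.
Qed.

Lemma sub_relaxation K d i : extended_soc K -> product K d ->
  K i `<=` relax K d i.
Proof.
move=> Ksoc Kd; case: (@relaxationP _ d i Kd) => [_ _ -> _|Ki aE a0 -> _|_ -> _] //.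
by rewrite Ki; apply: lorentz_sub_half_space; rewrite -Ki; exact: Kd.
Qed.

(** Opposites of nonzero vectors of the Lorentz cone leave it: [- apex] for a
    full space, and [- a], which lies on the bounding hyperplane, for the
    half-space of [a]. *)
Lemma relaxation_new_point K d i : product K d ->
  (H1 d K `|` H2 d K) i -> exists2 b, relax K d i b & ~ K i b.
Proof.
move=> Kd Hi; case: (@relaxationP _ d i Kd) => [Ki _ -> _|Ki aE a0 -> _|_ _ /(_ Hi)//].
  exists (- apex) => //; rewrite Ki /lorentz/= mxE apex0.
  by move=> /(le_trans (norm2_ge0 _)); rewrite oppr_ge0 ler10.
have Ka : 0 <= block d i 0 0 by rewrite -aE norm2_ge0.
exists (- block d i).
  rewrite /half_space/= -scaleN1r dotZr dot_reflection -sqr_norm2 aE.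
  by rewrite -expr2 subrr mulr0.
rewrite Ki /lorentz/= mxE => /(le_trans (norm2_ge0 _)); rewrite oppr_ge0 => aN.
by move: a0; rewrite eq_le Ka aN.
Qed.

Lemma relaxation_proper K d : extended_soc K -> product K d ->
  H1 d K `|` H2 d K !=set0 -> product K `<` product (relaxation K d).
Proof.
move=> Ksoc Kd [i Hi]; split.
  by move=> x Kx j; apply: sub_relaxation => //; exact: Kx.
have [b Db Kb] := @relaxation_new_point _ _ _ Kd Hi.
pose z : space := \mxrow_j dfwith (fun j => 0 : 'rV[R]_(m j).+1) i b j.
move=> sub; apply: Kb; have : product K z.
  apply: sub => j; rewrite mxrow_block; case: dfwithP => // k _.
  by have [] := esoc_factor_cone (@relaxation_extended _ _ Ksoc Kd k).
by move=> /(_ i); rewrite mxrow_block dfwithin.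
Qed.

Lemma sub_acore_relaxation K d i : extended_soc K -> product K d ->
  acore (K i) `<=` acore (relax K d i).
Proof.
move=> Ksoc Kd; have sub := @sub_relaxation _ _ i Ksoc Kd.
have Kcone := esoc_factor_cone (Ksoc i).
have Dcone := esoc_factor_cone (@relaxation_extended _ _ Ksoc Kd i).
case: (@relaxationP _ d i Kd) => [Ki _ _ _|Ki _ _ _ _|_ -> _ //];
  by apply: sub_acore => //; rewrite Ki lorentz_differences.
Qed.

(** This is what makes a relaxation harmless for feasibility: the directions
    that it adds to a factor are undone by moving along [d]. *)
Lemma relaxation_absorbs K d i (x : 'rV[R]_(m i).+1) : extended_soc K -> product K d ->
  acore (relax K d i) x ->
  exists2 t : R, 0 <= t & acore (K i) (x + t *: block d i).
Proof.
move=> Ksoc Kd; case: (@relaxationP _ d i Kd) => [Ki aC _ _ _|Ki aE a0 -> _|_ -> _ Kx].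
- rewrite Ki; apply: acore_absorbs aC; first exact: lorentz_cone.
  exact: lorentz_differences.
- move=> /half_space_acore; rewrite Ki => xr; apply: boundary_absorbs => //.
  exact/xr/reflection_neq0.
- by exists 0; rewrite ?scale0r ?addr0.
Qed.

(** The two quantities determine the status of a problem, up to the
    distinction between weak feasibility and weak infeasibility. *)
Lemma relaxation_step_invariants L c K K' : extended_soc K ->
  relaxation_step L K K' ->
  (strongly_feasible (product K) L c <-> strongly_feasible (product K') L c) /\
  (closure (msum (product K) [set` L]) c <->
   closure (msum (product K') [set` L]) c).
Proof.
move=> Ksoc [d [Kd Ld _ -> [sub _]]].
have K'soc := relaxation_extended Ksoc Kd.
have Kcone i : convex_cone (K i) by exact: esoc_factor_cone.
have K'cone i : convex_cone (relax K d i) by exact: esoc_factor_cone.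
have core : acore (product K) `<=` acore (product (relaxation K d)).
  move=> x /(product_acore _ Kcone) Kx; apply/product_acore => // i.
  exact: sub_acore_relaxation.
have absorb := product_absorbs Kcone K'cone Kd
  (fun i (x : 'rV[R]_(m i).+1) => @relaxation_absorbs _ d i x Ksoc Kd).
have KC := product_cone Kcone; have KC' := product_cone K'cone.
split; first exact: (strongly_feasible_relax _ KC KC' Ld core absorb).
apply: (closure_relax _ KC' sub Ld absorb).
exists (\mxrow_i sval (cid (esoc_factor_acore (K'soc i)))).
by apply/product_acore => // i; rewrite mxrow_block; case: cid.
Qed.

(** A nonzero Lorentz block of some [d] would allow a further relaxation by
    [d]. *)
Lemma lorentz_blocks_vanish L K :
  extended_soc K -> (forall K', ~ relaxation_step L K K') ->
  forall d i, product K d -> d \in L -> K i = lorentz -> block d i = 0.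
Proof.
move=> Ksoc Kmax d i Kd Ld Ki.
have noH : ~ (H1 d K `|` H2 d K !=set0).
  move=> H; apply: (Kmax (relaxation K d)); exists d; split=> //.
  exact: relaxation_proper.
by case: (@relaxationP _ d i Kd) => [_ _ _ Hi|_ _ _ _ Hi|/(_ Ki)//];
  case: noH; exists i.
Qed.

(** The Lorentz blocks [Z] and the polyhedral rest [P] satisfy [K + L = Z + (P
    + L)], and an element [z] of [Z] opposite to one of [P + L] gives a common
    element of [K] and [L] with the Lorentz blocks of [z]. *)
Lemma msum_closed_of_maximal L K :
  extended_soc K -> (forall K', ~ relaxation_step L K K') ->
  closed (msum (product K) [set` L]).
Proof.
move=> Ksoc Kmax; have vanish := lorentz_blocks_vanish Ksoc Kmax.
have Kcone i : convex_cone (K i) by exact: esoc_factor_cone.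
pose P : blocks R m := fun i => if `[< K i = lorentz >] then [set 0] else K i.
pose Z : blocks R m := fun i => if `[< K i = lorentz >] then lorentz else [set 0].
have PZ i : [\/ [/\ K i = lorentz, P i = [set 0] & Z i = lorentz]
             | [/\ K i <> lorentz, P i = K i & Z i = [set 0]]].
  by rewrite /P /Z; case: asboolP => Ki; [left|right].
have Pcone i : convex_cone (P i).
  by case: (PZ i) => -[_ -> _] //; exact: zero_cone.
have Zcone i : convex_cone (Z i).
  by case: (PZ i) => -[_ _ ->]; [exact: lorentz_cone|exact: zero_cone].
have Ppoly i : polyhedral (P i).
  case: (PZ i) => -[Ki -> _]; first exact: polyhedral_zero.
  case: (Ksoc i) Ki => [->|[->|[->//|[[e _ ->]|[e _ ->]]]]] _.
  - exact: polyhedral_zero.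
  - exact: polyhedral_setT.
  - exact: polyhedral_half_space.
  - exact: polyhedral_half_line.
have KPZ x y : product P x -> product Z y -> product K (x + y).
  move=> Px Zy i; rewrite blockD; move: (Px i) (Zy i).
  case: (PZ i) => -[Ki -> ->]; first by move=> -> Cy; rewrite add0r Ki.
  by move=> Kx ->; rewrite addr0.
have -> : msum (product K) [set` L] =
    msum (product Z) (msum (product P) [set` L]).
  apply/seteqP; split=> x.
    move=> [y Ky [l Ll <-]].
    pose z : space := \mxrow_i if `[< K i = lorentz >] then block y i else 0.
    have zE i : block z i = if `[< K i = lorentz >] then block y i else 0.
      exact: mxrow_block.
    exists z.
      by move=> i; rewrite /Z zE; case: asboolP => // <-; exact: Ky.
    exists (y - z + l); last by rewrite addrA addrCA subrr addr0.
    exists (y - z); last by exists l.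
    move=> i; rewrite blockB zE /P.
    by case: asboolP => Ki; [rewrite subrr|rewrite subr0; exact: Ky].
  move=> [z Zz [_ [y Py [l Ll <-]] <-]].
  by exists (y + z); [exact: KPZ|exists l; rewrite // addrA [z + y]addrC].
have Zcl : closed (product Z).
  apply: product_closed => i; case: (PZ i) => -[_ _ ->].
    exact: lorentz_closed.
  by apply: polyhedral_closed; exact: polyhedral_zero.
apply: msum_cone_closed => //.
- exact: product_cone.
- by apply: msum_cone; [exact: product_cone|exact: subspace_cone].
- apply: polyhedral_closed; apply: polyhedral_msum_subspace.
  exact: product_polyhedral.
move=> z Zz [y Py [l Ll yl]].
have Lyz : y + z \in L.
  have -> : y + z = - l; last by rewrite memvN.
  by apply/eqP; rewrite -addr_eq0 addrAC yl addNr.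
apply: block_inj => i; rewrite block0; have := Zz i; have := Py i.
case: (PZ i) => -[Ki -> ->] // y0 _.
have := vanish _ i (KPZ _ _ Py Zz) Lyz Ki.
by rewrite blockD y0 add0r.
Qed.

End Relaxation.

(** * Relaxation sequences *)

Section Sequences.
Context {R : realType} {q : nat} {m : 'I_q -> nat}.
Local Notation space := ('rV[R]_(\sum_i (m i).+1)).
Implicit Types (K : blocks R m) (L : {vspace space}) (Ks : seq (blocks R m)).

Lemma relaxation_sequence_invariants L (c : space) K Ks i :
  relaxation_sequence L K Ks -> (i < size Ks)%N ->
  (strongly_feasible (product K) L c <->
   strongly_feasible (product (nth K Ks i)) L c) /\
  (closure (msum (product K) [set` L]) c <->
   closure (msum (product (nth K Ks i)) [set` L]) c).
Proof.
move=> [_ K0 Ksoc step]; elim: i => [|i IH] iKs; first by rewrite K0.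
have [sf cl] := IH (ltnW iKs).
have [sf' cl'] := relaxation_step_invariants c (Ksoc _ (ltnW iKs)) (step _ iKs).
by split; [rewrite sf|rewrite cl].
Qed.

Lemma relaxation_sequence_rcons L K Ks K' :
  relaxation_sequence L K Ks -> relaxation_step L (last K Ks) K' ->
  relaxation_sequence L K (rcons Ks K').
Proof.
move=> [Ks0 K0 Ksoc step] stepK'.
have lastE : last K Ks = nth K Ks (size Ks).-1 by rewrite nth_last.
have K'soc : extended_soc K'.
  move: stepK' => [d [Kd _ _ -> _]]; apply: relaxation_extended => //.
  by rewrite lastE; apply: Ksoc; rewrite prednK.
split=> [| |i|i]; rewrite ?size_rcons ?nth_rcons ?Ks0// ltnS.
  by rewrite leq_eqVlt => /predU1P[->|iKs]; rewrite ?ltnn ?eqxx ?iKs//; exact: Ksoc.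
move=> iKs; rewrite iKs.
have [iKs1|iKs1|iKs1] := ltngtP i.+1 (size Ks); first exact: step.
  by move: iKs; rewrite leqNgt iKs1.
by move: stepK'; rewrite lastE -iKs1.
Qed.

End Sequences.

Theorem proposition7 (R : realType) (q : nat) (m : 'I_q -> nat)
    (K : blocks R m)
    (L : {vspace 'rV[R]_(\sum_i (m i).+1)}) (c : 'rV[R]_(\sum_i (m i).+1))
    (Ks : seq (blocks R m)) :
  extended_soc K ->
  maximal_relaxation_sequence L K Ks ->
  let Kg := last K Ks in
  [/\ strongly_feasible (product K) L c <->
        strongly_feasible (product Kg) L c,
      weak_status (product K) L c <-> weakly_feasible (product Kg) L c
    & strongly_infeasible (product K) L c <->
        strongly_infeasible (product Kg) L c].
Proof.
move=> _ [Kseq Kmax] Kg; have [Ks0 _ Ksoc _] := Kseq.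
have KgE : Kg = nth K Ks (size Ks).-1 by rewrite nth_last.
have gKs : ((size Ks).-1 < size Ks)%N by rewrite prednK.
have [sf cl] := relaxation_sequence_invariants c Kseq gKs.
rewrite -KgE in sf cl.
have Kgcl : closed (msum (product Kg) [set` L]).
  apply: msum_closed_of_maximal => [|K' stepK'].
    by rewrite KgE; exact: Ksoc.
  by apply: Kmax; exists K'; exact: relaxation_sequence_rcons.
split=> //; last by rewrite !strongly_infeasibleP cl.
by rewrite weak_statusP weakly_feasibleP sf cl -(proj1 (closure_id _) Kgcl).
Qed.
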